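(* Let $\mathcal C$ be a small category and $\mathbb X$ a $\mathcal C$-space. (1) For every object $c$ of $\mathcal C$, $\mathrm{TC}(\mathbb X(c))\leq\mathrm{TC}_{\mathcal C}(\mathbb X)$. (2) If $\mathcal C$ has finitely many objects and a weakly initial object, then \[ \mathrm{TC}\left(\varprojlim_{\mathcal C}\mathbb X\right)\leq\mathrm{TC}_{\mathcal C}(\mathbb X). \]
   Context: $\mathrm{Top}$ is the category of compactly generated topological spaces; limits, products, subspaces and mapping spaces are taken in compactly generated spaces (mapping spaces with the compactly generated compact-open topology). A $\mathcal C$-space is a functor $\mathbb X\colon\mathcal C\to\mathrm{Top}$; a $\mathcal C$-map is a natural transformation. Products are objectwise; a space $K$ is also regarded as a constant $\mathcal C$-space; $\mathbb I=[0,1]$. A $\mathcal C$-homotopy from $f$ to $g$ (with $f,g\colon\mathbb X\to\mathbb Y$) is a $\mathcal C$-map $H\colon\mathbb X\times\mathbb I\to\mathbb Y$ with $H_0=f$, $H_1=g$; then write $f\simeq_{\mathcal C}g$. An object $i$ of $\mathcal C$ is weakly initial if $\mathcal C(i,c)\neq\varnothing$ for every object $c$. An open $\mathcal C$-subspace $\mathbb U\subseteq\mathbb Y$ is a family of open subspaces $\mathbb U(c)\subseteq\mathbb Y(c)$ stable under the structure maps (with restricted structure maps); $\iota_{\mathbb U}\colon\mathbb U\hookrightarrow\mathbb Y$ is the inclusion. An open cover of $\mathbb Y$ is a collection $\{\mathbb U_i\}$ of open $\mathcal C$-subspaces with $\mathbb Y(c)=\bigcup_i\mathbb U_i(c)$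 for every object $c$. For a $\mathcal C$-map $p\colon\mathbb E\to\mathbb B$, an open $\mathcal C$-subspace $\mathbb U\subseteq\mathbb B$ is sectional for $p$ if there is a $\mathcal C$-map $s\colon\mathbb U\to\mathbb E$ with $p\circ s\simeq_{\mathcal C}\iota_{\mathbb U}$. $\mathrm{sec}_{\mathcal C}(p)$ is the least integer $n\ge0$ such that $\mathbb B$ has an open cover by $n+1$ sectional open $\mathcal C$-subspaces ($\infty$ if none exists). The path $\mathcal C$-space $\mathbb X^{\mathbb I}$ is given by $\mathbb X^{\mathbb I}(c)=\mathrm{Hom}_{\mathrm{Top}}(\mathbb I,\mathbb X(c))$, $\mathbb X^{\mathbb I}(\alpha)(\gamma)=\mathbb X(\alpha)\circ\gamma$; the endpoint evaluation $\pi_{\mathbb X}\colon\mathbb X^{\mathbb I}\to\mathbb X\times\mathbb X$ is $\pi_{\mathbb X,c}(\gamma)=(\gamma(0),\gamma(1))$; and $\mathrm{TC}_{\mathcal C}(\mathbb X)=\mathrm{sec}_{\mathcal C}(\pi_{\mathbb X})$. When $\mathcal C$ is the terminal category these give the ordinary (reduced) topological complexity $\mathrm{TC}(X)$ of a space $X$. *)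

(* Defs.v *)
From HB Require Import structures.
From mathcomp Require Import all_boot all_order all_algebra.
From mathcomp Require Import all_classical all_reals all_analysis.

Set Implicit Arguments.
Unset Strict Implicit.
Unset Printing Implicit Defensive.

Import Order.TTheory GRing.Theory Num.Theory.
Import numFieldNormedType.Exports.

Local Open Scope classical_set_scope.
Local Open Scope ring_scope.

(* [A] is k-open when its preimage under every continuous map from a compact
   Hausdorff space is open.  Following the usual convention for the category of
   compactly generated spaces, a space is compactly generated when its k-open
   sets are open; no (weak) Hausdorff condition is imposed. *)
Definition k_open (T : topologicalType) (A : set T) : Prop :=
  forall (K : topologicalType) (u : K -> T),
    compact [set: K] -> hausdorff_space K -> continuous u -> open (u @^-1` A).

HB.mixin Record isCompactlyGenerated T of Topological T := {
  k_open_open : forall A : set T, k_open A -> open A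
}.

#[short(type="cgType")]
HB.structure Definition CompactlyGenerated :=
  { T of Topological T & isCompactlyGenerated T }.

(* The k-ification: the same points, with the k-open sets as open sets.  It is
   right adjoint to the inclusion of compactly generated spaces into all
   topological spaces, so limits and subspaces of compactly generated spaces are
   the k-ifications of the ordinary ones. *)
Definition kification (T : Type) : Type := T.

Section kification_topology.
Variable T : topologicalType.

Lemma k_openT : k_open [set: T].
Proof. by move=> K u _ _ _; rewrite preimage_setT; exact: openT. Qed.

Lemma k_openI : setI_closed (@k_open T).
Proof.
move=> A B kA kB K u cK hK cu; rewrite preimage_setI.
by apply: openI; [exact: kA | exact: kB].
Qed.

Lemma k_open_bigU (J : Type) (f : J -> set T) :
  (forall j, k_open (f j)) -> k_open (\bigcup_j f j).
Proof.
move=> kf K u cK hK cu; rewrite preimage_bigcup.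
by apply: bigcup_open => j _; exact: kf.
Qed.

HB.instance Definition _ := Choice.copy (kification T) T.

HB.instance Definition _ :=
  isOpenTopological.Build (kification T) k_openT k_openI k_open_bigU.

Lemma kification_openE (A : set (kification T)) :
  open A = k_open (A : set T).
Proof. by []. Qed.

Lemma kification_k_open (A : set (kification T)) : k_open A -> open A.
Proof.
rewrite kification_openE => kA K u cK hK /continuousP cu.
apply: (kA K u) => //; apply/continuousP => B.
by rewrite kification_openE => kB; apply: kB => //; apply/continuousP.
Qed.

HB.instance Definition _ :=
  isCompactlyGenerated.Build (kification T) kification_k_open.

End kification_topology.

Lemma from_kification_continuous (T U : topologicalType) (f : T -> U) :
  continuous f -> continuous (f : kification T -> U).
Proof.
move=> /continuousP cf; apply/continuousP => A oA.
rewrite kification_openE => K u _ _ /continuousP cu.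
by rewrite -comp_preimage comp_preimage; apply: cu; exact: cf.
Qed.

Lemma to_kification_continuous (T : cgType) (U : topologicalType) (f : T -> U) :
  continuous f -> continuous (f : T -> kification U).
Proof.
move=> cf; apply/continuousP => A; rewrite kification_openE => kA.
apply: k_open_open => K u cK hK cu; apply: (kA K (f \o u)) => //.
by move=> x; apply: continuous_comp; [exact: cu | exact: cf].
Qed.

Lemma kification_continuous (T U : topologicalType) (f : T -> U) :
  continuous f -> continuous (f : kification T -> kification U).
Proof.
move=> cf; apply: (@to_kification_continuous (kification T)).
exact: from_kification_continuous.
Qed.

Lemma compact_hausdorff_k_open (T : topologicalType) :
  compact [set: T] -> hausdorff_space T -> forall A : set T, k_open A -> open A.
Proof. by move=> cT hT A kA; apply: (kA T id) => // x. Qed.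

Definition interval01 (R : realType) : Type := set_type `[(0 : R), 1]%classic.

Section interval01.
Variable R : realType.

HB.instance Definition _ := Topological.copy (interval01 R)
  (set_type `[(0 : R), 1]%classic).

Lemma interval01_compact : compact [set: interval01 R].
Proof.
move=> F FF _.
have FI : (set_val @ F) `[(0 : R), 1]%classic.
  apply: (@filterS _ F _ [set: interval01 R]) => [x _|]; last exact: filterT.
  exact: set_mem (valP x).
have [p [Ip clp]] := @segment_compact R 0 1 (set_val @ F) _ FI.
exists (exist _ p (mem_set Ip)); split => // A B FA [_ [[V oV <-] Vp VB]].
have svA : (set_val @ F) (set_val @` A).
  by apply: (@filterS _ F _ A) FA => x Ax; exists x.
have [_ [[x Ax <-] Vx]] := clp _ _ svA (open_nbhs_nbhs (conj oV Vp)).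
by exists x; split => //; exact: VB.
Qed.

Lemma interval01_hausdorff : hausdorff_space (interval01 R).
Proof.
move=> p q clpq; apply: val_inj; apply: (@norm_hausdorff R R) => A B nA nB.
have sv : continuous (set_val : interval01 R -> R) by exact: initial_continuous.
by have [x [Ax Bx]] := clpq _ _ (sv _ _ nA) (sv _ _ nB); exists (set_val x).
Qed.

HB.instance Definition _ := isCompactlyGenerated.Build (interval01 R)
  (compact_hausdorff_k_open interval01_compact interval01_hausdorff).

Lemma zero_in01 : (0 : R) \in `[(0 : R), 1]%classic.
Proof. by rewrite mem_setE in_itv /= lexx ler01. Qed.

Lemma one_in01 : (1 : R) \in `[(0 : R), 1]%classic.
Proof. by rewrite mem_setE in_itv /= lexx ler01. Qed.

Definition i0 : interval01 R := exist _ 0 zero_in01.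
Definition i1 : interval01 R := exist _ 1 one_in01.

End interval01.

(* [homcomp f g] is the composite "f, then g". *)
Record category := Category {
  Obj : Type;
  Mor : Obj -> Obj -> Type;
  idm : forall a, Mor a a;
  homcomp : forall a b c, Mor a b -> Mor b c -> Mor a c;
  homcomp_idl : forall a b (f : Mor a b), homcomp (idm a) f = f;
  homcomp_idr : forall a b (f : Mor a b), homcomp f (idm b) = f;
  homcomp_assoc : forall a b c d (f : Mor a b) (g : Mor b c) (h : Mor c d),
    homcomp f (homcomp g h) = homcomp (homcomp f g) h
}.

Definition weakly_initial (C : category) (i : Obj C) : Prop :=
  forall c : Obj C, inhabited (Mor i c).

Definition terminal_category : category.
Proof.
exists unit (fun _ _ => unit) (fun _ => tt) (fun _ _ _ _ _ => tt).
- by move=> a b [].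
- by move=> a b [].
- by [].
Defined.

Record cspace (C : category) := CSpace {
  cobj :> Obj C -> cgType;
  act : forall a b, Mor a b -> continuousType (cobj a) (cobj b);
  act_id : forall a (x : cobj a), act (idm a) x = x;
  act_comp : forall a b c (f : Mor a b) (g : Mor b c) (x : cobj a),
    act (homcomp f g) x = act g (act f x)
}.
Arguments act {C} X {a b} f : rename.

Section diagrams.
Variable C : category.

Record cmap (X Y : cspace C) := CMap {
  cmap_fun :> forall c, continuousType (X c) (Y c);
  cmap_nat : forall a b (f : Mor a b) (x : X a),
    cmap_fun b (act X f x) = act Y f (cmap_fun a x)
}.

Definition ccomp (X Y Z : cspace C) (g : cmap Y Z) (f : cmap X Y) : cmap X Z.
Proof.
exists (fun c => g c \o f c : continuousType (X c) (Z c)).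
by move=> a b h x /=; rewrite !cmap_nat.
Defined.

Definition cconst (K : cgType) : cspace C.
Proof.
by exists (fun=> K) (fun _ _ _ => idfun : continuousType K K).
Defined.

Definition prod_map (A B A' B' : Type) (f : A -> A') (g : B -> B')
  (p : A * B) : A' * B' := (f p.1, g p.2).

Lemma prod_map_continuous (A B A' B' : topologicalType)
    (f : A -> A') (g : B -> B') :
  continuous f -> continuous g -> continuous (prod_map f g).
Proof.
move=> cf cg x; apply: cvg_pair => /=.
- by apply: continuous_comp; [exact: cvg_fst | exact: cf].
- by apply: continuous_comp; [exact: cvg_snd | exact: cg].
Qed.

Definition cprod (X Y : cspace C) : cspace C.
Proof.
exists (fun c => kification (X c * Y c)%type : cgType)
  (fun a b f => mkcts (kification_continuous (prod_map_continuous
     (@cts_fun _ _ (act X f)) (@cts_fun _ _ (act Y f))))).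
- by move=> a [x y]; congr (_, _); exact: act_id.
- by move=> a b c f g [x y]; congr (_, _); exact: act_comp.
Defined.

Definition homotopic (R : realType) (X Y : cspace C) (f g : cmap X Y) : Prop :=
  exists H : cmap (cprod X (cconst (interval01 R))) Y,
    (forall c (x : X c), H c (x, i0 R) = f c x) /\
    (forall c (x : X c), H c (x, i1 R) = g c x).

Record open_csub (Y : cspace C) := OpenCSub {
  csub_set :> forall c, set (Y c);
  csub_open : forall c, open (@csub_set c);
  csub_stable : forall a b (f : Mor a b) (y : Y a),
    @csub_set a y -> @csub_set b (act Y f y)
}.
Arguments csub_set {Y} U c _ : rename.

Section csub.
Variables (Y : cspace C) (U : open_csub Y).

Definition csub_act a b (f : Mor a b) (y : set_type (U a)) : set_type (U b) :=
  exist _ (act Y f (val y)) (mem_set (csub_stable f (set_mem (valP y)))).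

Lemma csub_act_continuous a b (f : Mor a b) : continuous (csub_act f).
Proof.
apply: continuous_comp_initial => y.
have sv := @initial_continuous _ _ (set_val : set_type (U a) -> Y a) y.
exact: (continuous_comp sv (@cts_fun _ _ (act Y f) _)).
Qed.

Definition csub : cspace C.
Proof.
exists (fun c => kification (set_type (U c)) : cgType)
  (fun a b f => mkcts (kification_continuous (@csub_act_continuous a b f))).
- by move=> a y; apply: val_inj; rewrite /= act_id.
- by move=> a b c f g y; apply: val_inj; rewrite /= act_comp.
Defined.

Lemma csub_val_continuous c : continuous (set_val : set_type (U c) -> Y c).
Proof. exact: initial_continuous. Qed.

Definition csub_incl : cmap csub Y.
Proof.
exists (fun c => mkcts (from_kification_continuous (@csub_val_continuous c))
  : continuousType (csub c) (Y c)).
by [].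
Defined.

End csub.

Definition sectional (R : realType) (E B : cspace C) (p : cmap E B)
    (U : open_csub B) : Prop :=
  exists s : cmap (csub U) E, homotopic R (ccomp p s) (csub_incl U).

Definition open_cover (J : Type) (B : cspace C) (U : J -> open_csub B) : Prop :=
  forall c, \bigcup_j U j c = [set: B c].

Definition sectional_cover (R : realType) (E B : cspace C) (p : cmap E B)
    (n : nat) : Prop :=
  exists U : 'I_n.+1 -> open_csub B,
    open_cover U /\ forall j, sectional R p (U j).

Definition sec (R : realType) (E B : cspace C) (p : cmap E B) : \bar R :=
  if pselect (exists n, `[< sectional_cover R p n >]) is left ex
  then (ex_minn ex)%:R%:E else +oo%E.

End diagrams.
Arguments cconst C K : clear implicits.

Definition paths (R : realType) (T : topologicalType) : Type :=
  continuousType (interval01 R) T.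

HB.instance Definition _ (R : realType) (T : topologicalType) :=
  Choice.on (paths R T).
HB.instance Definition _ (R : realType) (T : topologicalType) :=
  Topological.copy (paths R T)
    (initial_topology (id : continuousType (interval01 R) T ->
                            {compact-open, interval01 R -> T})).

Section paths.
Variable R : realType.

Lemma paths_continuous (S T : topologicalType) (h : S -> paths R T) :
  continuous (h : S -> {compact-open, interval01 R -> T}) -> continuous h.
Proof. by move=> ch; apply: continuous_comp_initial. Qed.

Definition paths_map (S T : topologicalType) (f : continuousType S T)
  (g : paths R S) : paths R T := f \o g.

Lemma paths_map_continuous (S T : topologicalType) (f : continuousType S T) :
  continuous (paths_map f).
Proof.
have ci := @initial_continuous _ _
  (id : paths R S -> {compact-open, interval01 R -> S}).
apply: paths_continuous => g.
apply: (iffRL (compact_open_cvgP _ (fmap_filter _ (nbhs_filter g)))).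
move=> K V cK oV gKV.
have oW : open [set h : {compact-open, interval01 R -> S} |
    h @` K `<=` f @^-1` V].
  apply: compact_open_open => //.
  by move/continuousP : (@cts_fun _ _ f); apply.
have gW : ((g : {compact-open, interval01 R -> S}) @` K) `<=` f @^-1` V.
  by move=> _ [t Kt <-]; apply: gKV; exists t.
apply: (@filterS _ (nbhs g)) (ci g _ (open_nbhs_nbhs (conj oW gW))) => h hW _ [t Kt <-].
by apply: hW; exists t.
Qed.

Lemma evaluation_continuous (T : topologicalType) (t : interval01 R) :
  continuous (fun g : paths R T => g t).
Proof.
move=> g A; rewrite /= nbhsE => -[V [oV Vgt] VA].
have ci := @initial_continuous _ _
  (id : paths R T -> {compact-open, interval01 R -> T}).
have oW := compact_open_open (@compact_set1 (interval01 R) t) oV.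
have gW : ((g : {compact-open, interval01 R -> T}) @` [set t]) `<=` V.
  by move=> _ [_ -> <-].
apply: (@filterS _ (nbhs g)) (ci g _ (open_nbhs_nbhs (conj oW gW))) => h hW.
by apply: VA; apply: hW; exists t.
Qed.

Definition endpoints (T : topologicalType) (g : paths R T) : T * T :=
  (g (i0 R), g (i1 R)).

Lemma endpoints_continuous (T : topologicalType) : continuous (@endpoints T).
Proof.
by move=> g; apply: (@cvg_pair _ _ _ (nbhs g) _ _ _ _ _
  (fun h : paths R T => h (i0 R)) (fun h : paths R T => h (i1 R)));
  exact: evaluation_continuous.
Qed.

Variable C : category.

Definition cpaths (X : cspace C) : cspace C.
Proof.
exists (fun c => kification (paths R (X c)) : cgType)
  (fun a b f => mkcts (kification_continuous
    (@paths_map_continuous _ _ (act X f)))).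
- by move=> a g; apply/continuousEP => t; rewrite /= act_id.
- by move=> a b c f h g; apply/continuousEP => t; rewrite /= act_comp.
Defined.

Definition cendpoints (X : cspace C) : cmap (cpaths X) (cprod X X).
Proof.
exists (fun c => mkcts (kification_continuous (@endpoints_continuous (X c)))
  : continuousType (cpaths X c) (cprod X X c)).
by [].
Defined.

Definition TCC (X : cspace C) : \bar R := sec R (cendpoints X).

End paths.

Definition TC (R : realType) (T : cgType) : \bar R :=
  TCC R (cconst terminal_category T).

(* The product topology is k-ified only once, after passing to the subspace:
   this gives the same topology as k-ifying at both stages. *)
Definition climit (C : category) (X : cspace C) : cgType :=
  kification (set_type [set x : prod_topology (fun c => X c) |
    forall a b (f : Mor a b), act X f (x a) = x b]).

(* Main.v *)
Require Import Defs.
From HB Require Import structures.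
From mathcomp Require Import all_boot all_order all_algebra.
From mathcomp Require Import all_classical all_reals all_analysis.

Local Open Scope classical_set_scope.
Local Open Scope ereal_scope.

(** Both inequalities come from turning a cover of the C-space X x X by n + 1
    sectional open C-subspaces U_j into a cover of T x T by n + 1 sectional open
    subspaces V_j, where T is X(c) or the limit L of X ([TC_le_TCC]).

    For T = X(c) everything is evaluated at c: V_j is U_j(c), and the component
    at c of the section and of the homotopy over U_j do the job.

    For T = L, let i be weakly initial and let V_j be the set of pairs (x, y) in
    L x L with (x_i, y_i) in U_j(i).  It is the preimage of an open set under a
    continuous map, and the V_j cover L x L because the U_j(i) cover
    X(i) x X(i).  For every object c there is a morphism from i to c; it carries
    (x_i, y_i) to (x_c, y_c), and U_j is stable under it, so (x_c, y_c) lies in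
    U_j(c) for every (x, y) in V_j ([limit_openP]).  Hence the sections
    s_c : U_j(c) -> X(c)^I may be applied in all coordinates at once.  By
    naturality the paths s_c(x_c, y_c) form a compatible family, that is, a path
    in L; the homotopies are assembled in the same way ([limit_sectional]).

    The one delicate point is the continuity of the resulting map V_j -> L^I,
    because the topology of L is k-ified and so the compact-open topology on L^I
    is not described by the coordinates alone.  The exponential law
    ([paths_uncurry], [paths_curry]) moves the question to the k-ified product
    V_j x I, where continuity into L can be tested coordinate by coordinate
    ([climit_lift_continuous]). *)

(** * Continuity in k-ified spaces *)

Lemma hausdorff_prod (S T : topologicalType) :
  hausdorff_space S -> hausdorff_space T -> hausdorff_space (S * T)%type.
Proof.
move=> hS hT [s t] [s' t'] clst; congr (_, _).
- apply: hS => A B nA nB.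
  have [[x y] [/= Ax Bx]] := clst (fst @^-1` A) (fst @^-1` B)
    (@cvg_fst _ _ _ _ _ A nA) (@cvg_fst _ _ _ _ _ B nB).
  by exists x.
- apply: hT => A B nA nB.
  have [[x y] [/= Ax Bx]] := clst (snd @^-1` A) (snd @^-1` B)
    (@cvg_snd _ _ _ _ _ A nA) (@cvg_snd _ _ _ _ _ B nB).
  by exists y.
Qed.

Lemma pair_continuous (S T U : topologicalType) (f : S -> T) (g : S -> U) :
  continuous f -> continuous g -> continuous (fun s => (f s, g s)).
Proof.
move=> cf cg s.
exact: (@cvg_pair _ _ _ (nbhs s) (nbhs (f s)) (nbhs (g s)) _ _ _ f g
  (cf s) (cg s)).
Qed.

(** Continuous maps from compact Hausdorff spaces are the test maps that define
    k-open sets. *)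
Lemma compact_hausdorff_to_kification (K T : topologicalType) (f : K -> T) :
  compact [set: K] -> hausdorff_space K -> continuous f ->
  continuous (f : K -> kification T).
Proof.
by move=> cK hK cf; apply/continuousP => A; rewrite kification_openE; exact.
Qed.

(** The topology of [kification T] is finer than that of [T]. *)
Lemma continuous_kification_id (S T : topologicalType) (f : S -> kification T) :
  continuous f -> continuous (f : S -> T).
Proof.
have ci : continuous (id : kification T -> T).
  by apply: (@from_kification_continuous T T id) => t; exact: cvg_id.
move=> cf s; apply: (@continuous_comp _ _ _ f (id : kification T -> T)).
  exact: cf.
exact: ci.
Qed.

Lemma kification_prod_mapl_continuous (S S' T : topologicalType) (f : S -> S') :
  continuous f ->
  continuous (fun q : kification (S * T)%type =>
    (f q.1, q.2) : kification (S' * T)%type).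
Proof.
move=> cf; apply: kification_continuous.
by apply: (@prod_map_continuous _ _ _ _ f id) => // t; exact: cvg_id.
Qed.

(** Evaluation of paths is jointly continuous because the interval is compact
    Hausdorff. *)
Lemma paths_uncurry (R : realType) (S T : topologicalType) (h : S -> paths R T) :
  continuous h ->
  continuous (fun q : kification (S * interval01 R)%type => h q.1 q.2).
Proof.
move=> ch; apply: from_kification_continuous.
have -> : (fun q : S * interval01 R => h q.1 q.2) =
    uncurry (fun s => h s : {compact-open, interval01 R -> T}).
  by apply/funext => -[].
apply: continuous_uncurry.
- by move=> x _; rewrite withinET; exists setT;
    [exact: filterT | split; [exact: interval01_compact | exact: closedT]].
- exact: interval01_hausdorff.
- move=> s; apply: (@continuous_comp _ _ _ h
    (id : paths R T -> {compact-open, interval01 R -> T})); first exact: ch.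
  exact: initial_continuous.
- by move=> s; exact: cts_fun.
Qed.

(** The compact-open topology curries maps that are continuous on the ordinary
    product, whereas [f] is only continuous on its k-ification.  Since [S] is
    compactly generated, it is enough to curry after composing with a map
    [u : K -> S] from a compact Hausdorff space; then [K * interval01 R] is
    itself compact Hausdorff, so [u * id] remains continuous into the
    k-ification. *)
Lemma paths_curry (R : realType) (S : cgType) (T : topologicalType)
    (f : kification (S * interval01 R)%type -> T) :
  continuous f ->
  exists2 h : S -> paths R T, continuous h & forall s t, h s t = f (s, t).
Proof.
move=> cf.
have cslice s : continuous (fun t => f (s, t)).
  have cst : continuous ((fun t => (s, t)) :
      interval01 R -> kification (S * interval01 R)%type).
    apply: to_kification_continuous; apply: pair_continuous.
      exact: cst_continuous.
    by move=> t; exact: cvg_id.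
  by move=> t; exact: (continuous_comp (cst t) (cf _)).
exists (fun s => mkcts (cslice s)) => //.
apply/continuousP => V oV; apply: k_open_open => K u cK hK cu.
suff : continuous (fun k => mkcts (cslice (u k)) : paths R T).
  by move=> /continuousP; exact.
apply: paths_continuous.
have cKI : compact [set: K * interval01 R].
  by rewrite -setXTT; apply: compact_setX => //; exact: interval01_compact.
have hKI := hausdorff_prod _ _ hK (@interval01_hausdorff R).
have cv : continuous (prod_map u id : K * interval01 R -> S * interval01 R).
  by apply: prod_map_continuous => // t; exact: cvg_id.
have cvk := compact_hausdorff_to_kification _ _ _ cKI hKI cv.
apply: (@continuous_curry_fun _ _ _ (fun q => f (prod_map u id q))) => q.
exact: (continuous_comp (cvk q) (cf _)).
Qed.

(** * Limits *)

Lemma prod_topology_coord_continuous (I : Type) (T : I -> topologicalType) i :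
  continuous (fun f : prod_topology T => f i).
Proof.
move=> f.
have /cvg_sup/(_ i) fi : nbhs f --> (f : prod_topology T) by exact: cvg_id.
apply: cvg_trans (@initial_continuous _ _ (fun f : (forall i, T i) => f i) f).
exact: cvg_app.
Qed.

Lemma prod_topology_continuous (S : topologicalType) (I : Type)
    (T : I -> topologicalType) (h : S -> prod_topology T) :
  (forall i, continuous (fun s => h s i)) -> continuous h.
Proof.
move=> ch s; apply/cvg_sup => i.
exact: (@continuous_comp_initial _ _ _ (fun f : (forall i, T i) => f i) h (ch i)).
Qed.

Section limit.
Variables (C : category) (X : cspace C).

Definition climit_coord (c : Obj C) (x : climit X) : X c :=
  (val x : prod_topology (fun c => X c)) c.

Lemma climit_compat a b (f : Mor a b) (x : climit X) :
  act X f (climit_coord a x) = climit_coord b x.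
Proof. exact: (set_mem (valP x) a b f). Qed.

Lemma climit_coord_continuous c : continuous (climit_coord c).
Proof.
apply: from_kification_continuous => x.
apply: (@continuous_comp _ _ _ set_val
  (fun f : prod_topology (fun c => X c) => f c)).
  exact: initial_continuous.
exact: prod_topology_coord_continuous.
Qed.

(** A name for the set that underlies [climit X], which lets membership proofs
    be built for it. *)
Definition compatible_families : set (prod_topology (fun c => X c)) :=
  [set x | forall a b (f : Mor a b), act X f (x a) = x b].

Definition climit_lift (S : Type) (h : forall c, S -> X c)
    (hc : forall a b (f : Mor a b) s, act X f (h a s) = h b s) (s : S) :
  climit X :=
  exist _ (h ^~ s) (@mem_set _ compatible_families _ (fun a b f => hc a b f s)).

(** The universal property of the limit among compactly generated spaces: maps
    from such an [S] are not affected by the k-ification in [climit X]. *)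
Lemma climit_lift_continuous (S : cgType) (h : forall c, S -> X c)
    (hc : forall a b (f : Mor a b) s, act X f (h a s) = h b s) :
  (forall c, continuous (h c)) -> continuous (climit_lift S h hc).
Proof.
move=> ch; apply: to_kification_continuous.
apply: continuous_comp_initial; exact: prod_topology_continuous.
Qed.

Lemma climit_eq (x y : climit X) :
  (forall c, climit_coord c x = climit_coord c y) -> x = y.
Proof. by move=> xy; apply: val_inj; apply: functional_extensionality_dep. Qed.

End limit.

(** * Sectional covers and topological complexity of a space *)

Lemma sec_le (R : realType) (C D : category) (E B : cspace C) (p : cmap E B)
    (E' B' : cspace D) (p' : cmap E' B') :
  (forall n, sectional_cover R p n -> sectional_cover R p' n) ->
  sec R p' <= sec R p.
Proof.
move=> pp'; rewrite /sec.
case: pselect => [ex'|nex']; case: pselect => [ex|nex]; rewrite ?leey//.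
  case: ex_minnP => m _ minm; case: ex_minnP => n /asboolP /pp' cn _.
  by rewrite lee_fin Num.Theory.ler_nat; apply: minm; apply/asboolP.
by case: nex'; case: ex => n /asboolP /pp' cn; exists n; apply/asboolP.
Qed.

(** The next three declarations identify spaces over the terminal category with
    ordinary spaces, so that open subspaces and maps are given by their value at
    the single object. *)
Lemma act_terminal (Y : cspace terminal_category)
    (f : @Mor terminal_category tt tt) (y : Y tt) :
  act Y f y = y.
Proof. by case: f; exact: act_id. Qed.

Definition terminal_open (Y : cspace terminal_category) (A : set (Y tt))
  (oA : open A) : open_csub Y.
Proof.
exists (fun c => match c with tt => A end); first by case.
by move=> [] [] f y; rewrite act_terminal.
Defined.

Definition terminal_cmap (Y Z : cspace terminal_category)
  (h : continuousType (Y tt) (Z tt)) : cmap Y Z.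
Proof.
exists (fun c => match c return continuousType (Y c) (Z c) with tt => h end).
by move=> [] [] f y; rewrite !act_terminal.
Defined.

Lemma terminal_sectional (R : realType) (T : cgType)
    (A : set (kification (T * T)%type)) (oA : open A)
    (s : kification (set_type A) -> kification (paths R T))
    (H : kification (kification (set_type A) * interval01 R)%type ->
         kification (T * T)%type) :
  continuous s -> continuous H ->
  (forall x, H (x, i0 R) = endpoints (s x)) ->
  (forall x, H (x, i1 R) = set_val x) ->
  sectional R (cendpoints R (cconst terminal_category T))
    (terminal_open (cprod (cconst _ T) (cconst _ T)) A oA).
Proof.
move=> cs cH H0 H1.
pose U := terminal_open (cprod (cconst _ T) (cconst _ T)) A oA.
exists (terminal_cmap (csub U) (cpaths R (cconst _ T)) (mkcts cs)).
exists (terminal_cmap (cprod (csub U) (cconst _ (interval01 R)))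
  (cprod (cconst _ T) (cconst _ T)) (mkcts cH)).
by split=> -[].
Qed.

(** [V] is the passage from open C-subspaces of X x X to open sets of T x T; it
    acts on one subspace at a time, so it keeps the size of a cover. *)
Lemma TC_le_TCC (R : realType) (T : cgType) (C : category) (X : cspace C)
    (V : open_csub (cprod X X) -> set (kification (T * T)%type))
    (oV : forall U, open (V U)) :
  (forall J (U : J -> open_csub (cprod X X)), open_cover U ->
    \bigcup_j V (U j) = setT) ->
  (forall U, sectional R (cendpoints R X) U ->
    sectional R (cendpoints R (cconst terminal_category T))
    (terminal_open (cprod (cconst _ T) (cconst _ T)) (V U) (oV U))) ->
  TC R T <= TCC R X.
Proof.
move=> Vcov Vsec; apply: sec_le => n [U [Ucov Usec]].
exists (fun j =>
  terminal_open (cprod (cconst _ T) (cconst _ T)) (V (U j)) (oV (U j))).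
by split=> [[]|j]; [exact: Vcov | exact: Vsec].
Qed.

(** * The two inequalities *)

Lemma TC_object_le (R : realType) (C : category) (X : cspace C) (c : Obj C) :
  TC R (X c) <= TCC R X.
Proof.
apply: (@TC_le_TCC R (X c) C X (fun U => U c) (fun U => csub_open U c)).
  by move=> J U; apply.
move=> U [s [H [H0 H1]]].
apply: (@terminal_sectional R (X c) (U c) (csub_open U c) (s c) (H c)).
- exact: cts_fun.
- exact: cts_fun.
- by move=> x; rewrite H0.
- by move=> x; rewrite H1.
Qed.

Section limit_sections.
Variables (R : realType) (C : category) (X : cspace C) (i : Obj C).
Hypothesis wi : weakly_initial i.

Notation L := (climit X).

Definition pair_coord (c : Obj C) : kification (L * L)%type -> cprod X X c :=
  prod_map (climit_coord C X c) (climit_coord C X c).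

Lemma pair_coord_continuous c : continuous (pair_coord c).
Proof.
apply: kification_continuous; apply: prod_map_continuous;
  exact: climit_coord_continuous.
Qed.

Lemma pair_coord_compat a b (f : Mor a b) x :
  act (cprod X X) f (pair_coord a x) = pair_coord b x.
Proof. by congr (_, _); exact: climit_compat. Qed.

Variable U : open_csub (cprod X X).

Definition limit_open : set (kification (L * L)%type) := pair_coord i @^-1` U i.

Lemma limit_open_open : open limit_open.
Proof.
by have /continuousP := pair_coord_continuous i; apply; exact: csub_open.
Qed.

(** Membership at the weakly initial object forces membership at every object,
    by stability of [U] under the structure maps. *)
Lemma limit_openP c x : limit_open x -> U c (pair_coord c x).
Proof.
by case: (wi c) => f Ux; rewrite -(pair_coord_compat _ _ f); exact: csub_stable.
Qed.

Definition limit_open_coord c (x : kification (set_type limit_open)) : csub U c :=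
  exist _ (pair_coord c (val x)) (mem_set (limit_openP c _ (set_mem (valP x)))).

Lemma limit_open_coord_continuous c : continuous (limit_open_coord c).
Proof.
apply: kification_continuous; apply: continuous_comp_initial => x.
exact: (continuous_comp (@initial_continuous _ _ set_val x)
  (pair_coord_continuous c _)).
Qed.

Lemma limit_open_coord_compat a b (f : Mor a b) x :
  act (csub U) f (limit_open_coord a x) = limit_open_coord b x.
Proof. by apply: val_inj; exact: pair_coord_compat. Qed.

(** The section and the homotopy over [limit_open] are the limits over [c] of
    those over [U c]; naturality gives the compatible families, and the
    exponential law reduces the continuity of the section to coordinates. *)
Lemma limit_sectional :
  sectional R (cendpoints R X) U ->
  sectional R (cendpoints R (cconst terminal_category L))
    (terminal_open (cprod (cconst _ L) (cconst _ L)) limit_open limit_open_open).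
Proof.
move=> [s [H [H0 H1]]].
(* [V] and [VI] are packed as compactly generated spaces, since currying and
   the universal property of the limit apply to maps out of these. *)
pose V : cgType := kification (set_type limit_open).
pose VI : cgType := kification (V * interval01 R)%type.
have cs c : continuous (fun x : V => s c (limit_open_coord c x) : paths R (X c)).
  move=> x; apply: (@continuous_comp _ _ _ (limit_open_coord c)
    (s c : csub U c -> paths R (X c)));
    first exact: limit_open_coord_continuous.
  by apply: continuous_kification_id; exact: cts_fun.
have scompat a b (f : Mor a b) (q : VI) :
    act X f (s a (limit_open_coord a q.1) q.2) = s b (limit_open_coord b q.1) q.2.
  by rewrite -(limit_open_coord_compat _ _ f) cmap_nat.
pose sL := climit_lift C X VI _ scompat.
have csL : continuous sL.
  by apply: climit_lift_continuous => c; exact: (paths_uncurry _ _ _ _ (cs c)).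
have [sV csV sVE] := paths_curry R V L sL csL.
have Hcompat a b (f : Mor a b) (q : VI) :
    act (cprod X X) f (H a (limit_open_coord a q.1, q.2)) =
    H b (limit_open_coord b q.1, q.2).
  by rewrite -cmap_nat -(limit_open_coord_compat _ _ f).
have cHc c : continuous (fun q : VI => H c (limit_open_coord c q.1, q.2)).
  have cm := @kification_prod_mapl_continuous _ _ (interval01 R) _
    (limit_open_coord_continuous c).
  move=> q.
  exact: (@continuous_comp _ _ _ _ (H c) q (cm q) (@cts_fun _ _ (H c) _)).
have Hfst a b (f : Mor a b) (q : VI) :
  act X f (H a (limit_open_coord a q.1, q.2)).1 =
    (H b (limit_open_coord b q.1, q.2)).1 by rewrite -(Hcompat _ _ f).
have Hsnd a b (f : Mor a b) (q : VI) :
  act X f (H a (limit_open_coord a q.1, q.2)).2 =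
    (H b (limit_open_coord b q.1, q.2)).2 by rewrite -(Hcompat _ _ f).
have cHX c : continuous
    (fun q : VI => H c (limit_open_coord c q.1, q.2) : X c * X c).
  exact: (continuous_kification_id _ _ _ (cHc c)).
pose HL (q : VI) : kification (L * L)%type :=
  (climit_lift C X VI _ Hfst q, climit_lift C X VI _ Hsnd q).
apply: (@terminal_sectional R L _ limit_open_open sV HL).
- exact: to_kification_continuous csV.
- apply: to_kification_continuous; apply: pair_continuous.
  + apply: climit_lift_continuous => c x.
    by apply: (@continuous_comp _ _ _ _ fst x (cHX c x)); exact: cvg_fst.
  + apply: climit_lift_continuous => c x.
    by apply: (@continuous_comp _ _ _ _ snd x (cHX c x)); exact: cvg_snd.
- by move=> x; congr (_, _); apply: climit_eq => c;
    rewrite sVE /climit_coord /= H0.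
- move=> x; rewrite [RHS]surjective_pairing.
  by congr (_, _); apply: climit_eq => c; rewrite /climit_coord /= H1.
Qed.

End limit_sections.

Lemma TC_climit_le (R : realType) (C : category) (X : cspace C) (i : Obj C) :
  weakly_initial i -> TC R (climit X) <= TCC R X.
Proof.
move=> wi; apply: (@TC_le_TCC R _ C X (limit_open C X i) (limit_open_open C X i)).
  by move=> J U Ucov; rewrite -(preimage_setT (pair_coord C X i)) -(Ucov i).
by move=> U; exact: limit_sectional.
Qed.

Theorem proposition5p10 (R : realType) (C : category) (X : cspace C) :
  (forall c : Obj C, TC R (X c) <= TCC R X) /\
  (finite_set [set: Obj C] ->
   (exists i : Obj C, weakly_initial i) ->
   TC R (climit X) <= TCC R X).
Proof.
split=> [c|_ [i wi]]; first exact: TC_object_le.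
exact: TC_climit_le wi.
Qed.
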